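(* Consider a classification task with class set $\mathcal{Y}$ and class descriptions $\{v_y\}_{y\in\mathcal{Y}}$, let $\{r_y\}_{y\in\mathcal{Y}}\subset\Gamma$ be the verbalizers used for the classes, and let $z^*$ be the value of the latent variable $z$ representing that each description $v_y$ is associated with the corresponding verbalizer $r_y$. For inputs $x_1,x_2,\dots$ let $r_t$ be the correct verbalizer for $x_t$ (that is, $r_t=r_y$ where $y$ is the label of $x_t$), let $d$ be the delimiter, and let $S_t = x_1, r_1, d, x_2, r_2, d, \dots, x_t, r_t, d$, with $S_0$ the empty sequence. Let $T$ be a positive integer. Assume that under $z^*$ the sub-sequences separated by the delimiter $d$ are independent of each other, namely $$\Pr(x_1,r_1,d,x_2,r_2,d,\dots,x_T,r_T,d\mid z^* )=\prod_{t=1}^T \Pr(x_t,r_t,d\mid z^* ).$$ Assume also that, by consistency of the language model, $\Pr(r_t,d\mid x_t,z^*,S_{t-1})=1$ for all $t$. If the downstream task input distribution $\mathcal{D}_X$ is $\Pr(x\mid z^* )$, then $$\mathop{\mathbb{E}}_{x_1,\dots,x_T\sim \mathcal{D}_X^T}\left[\frac{1}{T}\sum_{t=1}^T \log \Pr(r_t\mid x_t,S_{t-1})\right]\;\geq\;\frac{1}{T}\log\Pr(z^* ).$$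
   Context: Language model as a latent variable model. A document is a concatenation of paragraphs separated by a delimiter $d$. There is a set $\Gamma$ of words (expressions) that can be associated with variable meanings. A discrete latent variable $z$, with prior $\Pr(z)$, specifies which meaning each expression in the document is associated with, consistently throughout the document. Given $z$, the document is drawn from a conditional distribution $\Pr(\cdot\mid z)$, and the language model's distribution is the marginal $\Pr(\cdot)=\sum_z \Pr(z)\Pr(\cdot\mid z)$. A prompt is a sequence of consecutive blocks input, verbalizer, delimiter, input, verbalizer, delimiter, and so on. Here $\Pr(S_t)$ and $\Pr(S_t\mid z)$ are the probabilities that a document begins with the sequence $S_t$ of blocks. All conditional probabilities are formed from the joint distribution of $z$ and the blocks: for example, $\Pr(r_t\mid x_t,S_{t-1})$ is the conditional probability that the block following $S_{t-1},x_t$ is $r_t$, and $\Pr(r_t,d\mid x_t,z^*,S_{t-1})$ is the conditional probability, given $z=z^*$, that the two blocks following $S_{t-1},x_t$ are $r_t$ and $d$. In the factorization, $\Pr(x,r,d\mid z^* )$ is the conditional distribution given $z=z^*$ of a single paragraph consisting of an input block, a verbalizer block and a delimiter (the same distribution for each paragraph), and $\Pr(x\mid z^* )$ is its marginal distribution on the input block, a probability distribution on a countable set of inputs. $\mathcal{D}_X^T$ is the law of $T$ independent draws from $\mathcal{D}_X$. It is understood that $\Pr(z^* )>0$. A classification task maps inputs to classes in $\mathcal{Y}$, and each class $y\in\mathcal{Y}$ is described by a natural-language description $v_y$. A verbalizer $r_y\in\Gamma$ is the expression used in the prompt in place of the class $y$. Consistency: a paragraph with non-zero probability contains no two contradictory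 sentences. The paper uses this standing assumption in the form that, given $z^*$ and $x_t$, any output other than the correct verbalizer has probability zero, so that $\log \Pr(r_t,d\mid x_t,z^*,S_{t-1})=0$. *)

(* Defs.v *)
From HB Require Import structures.
From mathcomp Require Import all_boot all_order all_algebra.
From mathcomp Require Import all_classical all_reals all_analysis.

Set Implicit Arguments.
Unset Strict Implicit.
Unset Printing Implicit Defensive.

Import Order.TTheory GRing.Theory Num.Theory.
Local Open Scope classical_set_scope.
Local Open Scope ring_scope.

(* A document is a finite or infinite sequence of blocks, w i being the block
   at position i and None standing for "past the end of the document".  Sequences with gaps are not
   excluded, since only probabilities of prefixes are ever used. *)
Definition raw_document (Block : countType) : Type := nat -> option Block.

HB.instance Definition _ (Block : countType) :=
  Pointed.on (raw_document Block).

Definition begins_with (Block : countType) (S : seq Block) :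
    set (raw_document Block) :=
  [set w | forall i : nat, (i < size S)%N -> w i = onth S i].

(* Documents carry the sigma-algebra generated by the events "the document
   begins with S". *)
Definition document (Block : countType) :=
  g_sigma_algebraType (range (@begins_with Block)).

(* [meaning z g] is the meaning that the latent value z associates with the
   expression g; it is only relevant for g in [words], the set Gamma. *)
Record latent_model (R : realType) (Block : countType) (Z : choiceType)
    (Meaning : Type) := LatentModel {
  words : set Block ;
  meaning : Z -> Block -> Meaning ;
  prior : Z -> R ;
  prior_ge0 : forall z, 0 <= prior z ;
  prior_sum1 : (\esum_(z in [set: Z]) (prior z)%:E = 1)%E ;
  law : Z -> probability (document Block) R
}.

Section model_probabilities.
Context {R : realType} {Block : countType} {Z : choiceType} {Meaning : Type}.
Variable M : latent_model R Block Z Meaning.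
Implicit Types (z : Z) (S U : seq Block).

(* Pr(S | z) *)
Definition Pr_given z S : R := fine (law M z (begins_with S)).

(* Pr(S) = \sum_z Pr(z) Pr(S | z) *)
Definition Pr S : R :=
  fine (\esum_(z in [set: Z])
    ((prior M z)%:E * law M z (begins_with S)))%E.

(* Pr(U | S, z): the blocks following S are U.  As x / 0 = 0, this is only
   meaningful when 0 < Pr_given z S. *)
Definition Pr_next_given z S U : R := Pr_given z (S ++ U) / Pr_given z S.

(* Pr(U | S), only meaningful when 0 < Pr S. *)
Definition Pr_next S U : R := Pr (S ++ U) / Pr S.

End model_probabilities.

(* The prompt x_1, r_1, d, ..., x_n, r_n, d, where [r a] is the correct
   verbalizer of the input a. *)
Definition prompt (X : Type) (Block : countType) (input : X -> Block)
    (r : X -> Block) (d : Block) (x : seq X) : seq Block :=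
  flatten [seq [:: input a; r a; d] | a <- x].

(* The law D^n of n independent draws from D, by recursion on n: the image of
   the product measure D \x D^n under (a, t) |-> a :: t. *)
Section iid_draws.
Context {R : realType} {dX : measure_display} {X : measurableType dX}.
Variable D : probability X R.

Definition tcons n (p : X * n.-tuple X) : n.+1.-tuple X :=
  [tuple of p.1 :: p.2].

Lemma measurable_tcons n : measurable_fun [set: X * n.-tuple X] (@tcons n).
Proof. exact: measurable_cons measurable_fst measurable_snd. Qed.

HB.instance Definition _ n :=
  isMeasurableFun.Build _ _ _ _ (@tcons n) (@measurable_tcons n).

Section step.
Context {n : nat}.
Variable P : probability (n.-tuple X) R.

Definition draw_pair := (D \x P)%E.

HB.instance Definition _ := Measure.on draw_pair.

Lemma draw_pair_setT : draw_pair [set: X * n.-tuple X] = 1%E.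
Proof.
rewrite /draw_pair -setXTT product_measure1E// -[RHS](mule1 1%E).
by congr (_ * _)%E; exact: probability_setT.
Qed.

HB.instance Definition _ :=
  Measure_isProbability.Build _ _ _ draw_pair draw_pair_setT.

End step.

Fixpoint iid n : probability (n.-tuple X) R :=
  match n with
  | 0 => \d_([tuple] : 0.-tuple X)
  | n'.+1 => distribution (draw_pair (iid n')) (@tcons n')
  end.

End iid_draws.

(* Main.v *)
(* Consistency forces the law Q of the inputs x_1, ..., x_T to agree with
   Pr(S_T | z* ), so that Pr(S_T) >= Pr(z* ) Q(x).  By the chain rule Pr(S_T) is
   at most q(x) \prod_t Pr(r_t | x_t, S_{t-1}), where
   q(x) = \prod_t Pr(x_t | S_{t-1}) is a subprobability.  Hence
   \sum_t log Pr(r_t | x_t, S_{t-1}) >= log Pr(z* ) + log (Q(x) / q(x)), and the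
   last term has nonnegative expectation under Q by Gibbs' inequality. *)

Require Import Defs.
From mathcomp Require Import all_boot all_order all_algebra finmap.
From mathcomp Require Import ring lra.
From mathcomp Require Import all_classical all_reals all_analysis.

Set Implicit Arguments.
Unset Strict Implicit.
Unset Printing Implicit Defensive.

Import Order.TTheory GRing.Theory Num.Theory.
Local Open Scope classical_set_scope.
Local Open Scope ring_scope.

(** * Sums of extended reals over arbitrary index sets *)

Lemma esum_le_finite (R : realType) (I : choiceType) (D : set I)
    (a : I -> \bar R) (c : \bar R) :
  (forall X : {fset I}, [set` X] `<=` D -> \sum_(i <- X) a i <= c)%E ->
  (\esum_(i in D) a i <= c)%E.
Proof.
move=> ac; apply: ge_ereal_sup => _ [X [finX XD] <-].
by rewrite fsbig_finite//=; apply: ac; rewrite fset_setK.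
Qed.

Lemma esum_ge_term (R : realType) (I : choiceType) (D : set I)
    (a : I -> \bar R) (i : I) :
  D i -> (0 <= a i)%E -> (a i <= \esum_(j in D) a j)%E.
Proof.
move=> Di ai; apply: esum_ge; exists [set i]; last by rewrite fsbig_set1.
by split; [exact: finite_set1|move=> _ ->].
Qed.

Lemma esumZl_le (R : realType) (I : choiceType) (D : set I)
    (a : I -> \bar R) (c : R) : 0 <= c -> (forall i, 0 <= a i)%E ->
  (\esum_(i in D) (c%:E * a i) <= c%:E * \esum_(i in D) a i)%E.
Proof.
move=> c0 a0; apply: esum_le_finite => X XD.
rewrite -ge0_sume_distrr//; apply: lee_wpmul2l; first by rewrite lee_fin.
apply: esum_ge; exists [set` X]; first by split.
by rewrite fsbig_finite//= set_fsetK.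
Qed.

(** Additivity on the finite union of the chosen sets, then monotonicity; restricting to finite [X]
    lets [I] be any index type. *)
Lemma sum_measure_trivIset_le d (T : measurableType d) (R : realType)
    (mu : {measure set T -> \bar R}) (I : choiceType) (F : I -> set T)
    (A : set T) (X : {fset I}) :
    measurable A -> (forall i, measurable (F i)) ->
    trivIset [set: I] F -> (forall i, F i `<=` A) ->
  (\sum_(i <- X) mu (F i) <= mu A)%E.
Proof.
move=> mA mF tF FA.
have -> : (\sum_(i <- X) mu (F i) = \sum_(i \in [set` X]) mu (F i))%E.
  by rewrite fsbig_finite//= set_fsetK.
rewrite -measure_fin_bigcup//; last exact: sub_trivIset tF.
apply: le_measure; rewrite ?inE//; last exact: bigcup_sub.
exact: fin_bigcup_measurable.
Qed.

(** * Integration on a countable discrete space *)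

Section countable_space.
Context d (T : measurableType d) (R : realType).
Hypotheses (cT : countable [set: T]) (mT : forall x : T, measurable [set x]).

Lemma countable_measurableT (A : set T) : measurable A.
Proof.
apply: countable_measurable => //; apply: sub_countable cT.
exact: subset_card_le.
Qed.

Lemma countable_measurable_fun d' (T' : sigmaRingType d') (f : T -> T') :
  measurable_fun [set: T] f.
Proof. by move=> _ B _; exact: countable_measurableT. Qed.

(** An injection [h] into the naturals cuts the space into countably many fibres, each empty or a
    single point on which [f] is constant. *)
Lemma ge0_integral_countable (mu : {measure set T -> \bar R})
    (f : T -> \bar R) : (forall x, 0 <= f x)%E ->
  (\int[mu]_x f x = \esum_(x in [set: T]) (f x * mu [set x]))%E.
Proof.
move=> f0; have /countable_injP[h hinj] := cT.
pose F k := h @^-1` [set k].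
have F1 x : F (h x) = [set x].
  by apply/seteqP; split => [y /= hy|_ ->//]; apply: hinj; rewrite ?inE.
have TF : [set: T] = \bigcup_k F k.
  by apply/seteqP; split => // x _; exists (h x).
have f_mu0 x : (0 <= f x * mu [set x])%E by rewrite mule_ge0.
rewrite [in LHS]TF ge0_integral_bigcup//; last 3 first.
- by move=> k; exact: countable_measurableT.
- by rewrite -TF; exact: countable_measurable_fun.
- exact: trivIset_preimage1.
rewrite TF nneseries_sum_bigcup//; last exact: trivIset_preimage1.
apply: eq_eseriesr => k _.
have [[x <-]|Fk0] := pselect (exists x, h x = k).
  rewrite F1 esum_set1//.
  rewrite (eq_integral (cst (f x))) ?integral_cst//.
  by move=> y; rewrite inE => ->.
have -> : F k = set0 by rewrite -subset0 => x hx; apply: Fk0; exists x.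
by rewrite integral_set0 esum_set0.
Qed.

End countable_space.

(** * Tuples of inputs and the law of independent draws *)

Section tuples.
Context d (X : measurableType d) (R : realType).
Hypotheses (cX : countable [set: X]) (mX : forall x : X, measurable [set x]).

Lemma countable_tuple n : countable [set: n.-tuple X].
Proof.
have /countable_injP[h hinj] := cX.
apply/countable_injP; exists (fun x : n.-tuple X => choice.pickle (map h x)).
move=> x y _ _ /(pcan_inj choice.pickleK) /inj_map exy.
apply: val_inj; apply: exy.
by move=> a b; apply: hinj; rewrite inE.
Qed.

Lemma measurable_tuple1 n (x : n.-tuple X) : measurable [set x].
Proof.
have -> : [set x] = \bigcap_(i in [set: 'I_n])
    ((fun y : n.-tuple X => tnth y i) @^-1` [set tnth x i]).
  apply/seteqP; split => [_ -> //|y yx].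
  by apply: eq_from_tnth => i; exact: yx.
apply: fin_bigcap_measurable => // i _; rewrite -[X in measurable X]setTI.
exact: measurable_tnth.
Qed.

Lemma iid_set1 (D : probability X R) n (x : n.-tuple X) :
  iid D n [set x] = (\prod_(i < n) D [set tnth x i])%E.
Proof.
elim: n x => [x|n IHn x].
  by rewrite big_ord0 /= diracE mem_set//= (tuple0 x).
case/tupleP: x => a x.
rewrite big_ord_recl tnth0; under eq_bigr do rewrite tnthS.
rewrite -IHn /= /distribution /pushforward/=.
have -> : @tcons _ X n @^-1` [set [tuple of a :: x]] = [set a] `*` [set x].
  apply/seteqP; split => [[b y]/= /(congr1 val)/= [-> yx]|[b y] [/= -> ->]//].
  by split => //=; exact: val_inj.
by rewrite /draw_pair product_measure1E//; exact: measurable_tuple1.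
Qed.

Lemma esum_tupleS n (f : n.+1.-tuple X -> \bar R) : (forall x, 0 <= f x)%E ->
  (\esum_(x in [set: n.+1.-tuple X]) f x =
   \esum_(a in [set: X]) \esum_(x in [set: n.-tuple X])
     f [tuple of a :: x])%E.
Proof.
move=> f0; rewrite (@esum_esum R X (n.-tuple X) _ _
  (fun (a : X) (x : n.-tuple X) => f [tuple of a :: x]))//.
apply: (@reindex_esum R _ _ _ _
  (fun k : X * n.-tuple X => [tuple of k.1 :: k.2])).
split => // [[a x] [b y] _ _ /(congr1 val)/= [-> xy]|x _].
  by congr pair; exact: val_inj.
by exists (thead x, [tuple of behead x]) => //=; rewrite -tuple_eta.
Qed.

End tuples.

(** * Prefix events *)

Lemma measurable_begins_with (Block : countType) (U : seq Block) :
  measurable (begins_with U : set (document Block)).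
Proof. by apply: sub_sigma_algebra; exists U. Qed.

Lemma begins_with_nil (Block : countType) :
  begins_with [::] = [set: raw_document Block].
Proof. by apply/seteqP; split. Qed.

Lemma begins_with_cat (Block : countType) (U V : seq Block) :
  begins_with (U ++ V) `<=` begins_with U.
Proof.
move=> w wUV i iU; rewrite wUV ?size_cat ?ltn_addr//.
by rewrite !onthE map_cat nth_cat size_map iU.
Qed.

(** The block at position [size U] is [f i], so a document determines [i]. *)
Lemma trivIset_begins_with_rcons (Block : countType) (I : eqType)
    (U : seq Block) (f : I -> Block) (V : I -> seq Block) : injective f ->
  trivIset [set: I] (fun i => begins_with (rcons U (f i) ++ V i)).
Proof.
move=> finj i j _ _ [w [/begins_with_cat wi /begins_with_cat wj]].
have := wi (size U); have := wj (size U).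
rewrite !size_rcons => ->; rewrite ?ltnSn // => /(_ isT).
by rewrite -!cats1 !onthE !map_cat !nth_cat !size_map ltnn subnn /= => -[/finj].
Qed.

(** * Probabilities of prefixes, given the latent value and marginally *)

Section prefix_probabilities.
Context {R : realType} {Block : countType} {Z : choiceType} {Meaning : Type}.
Variable M : latent_model R Block Z Meaning.
Implicit Types (z : Z) (U V : seq Block).

Lemma Pr_givenE z U : (Pr_given M z U)%:E = law M z (begins_with U).
Proof.
by rewrite fineK//; apply: fin_num_measure; exact: measurable_begins_with.
Qed.

Lemma Pr_given_ge0 z U : 0 <= Pr_given M z U.
Proof. exact/fine_ge0/measure_ge0. Qed.

Lemma law_begins_with_cat z U V :
  (law M z (begins_with (U ++ V)) <= law M z (begins_with U))%E.
Proof.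
apply: le_measure; rewrite ?inE; last exact: begins_with_cat.
- exact: measurable_begins_with.
- exact: measurable_begins_with.
Qed.

Lemma law_begins_with_le1 z U : (law M z (begins_with U) <= 1)%E.
Proof. by apply: probability_le1; exact: measurable_begins_with. Qed.

Let joint_ge0 z U : (0 <= (prior M z)%:E * law M z (begins_with U))%E.
Proof. by rewrite mule_ge0// lee_fin prior_ge0. Qed.

Lemma PrE U : (Pr M U)%:E =
  (\esum_(z in [set: Z]) ((prior M z)%:E * law M z (begins_with U)))%E.
Proof.
rewrite fineK// ge0_fin_numE ?esum_ge0//.
apply: (@le_lt_trans _ _ 1%E); last exact: ltry.
rewrite -(prior_sum1 M); apply: le_esum => z _.
by rewrite -[leRHS]mule1 lee_wpmul2l ?lee_fin ?prior_ge0// law_begins_with_le1.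
Qed.

Lemma Pr_ge0 U : 0 <= Pr M U.
Proof. by rewrite -lee_fin PrE esum_ge0. Qed.

Lemma Pr_nil : Pr M [::] = 1.
Proof.
apply: EFin_inj; rewrite PrE begins_with_nil -(prior_sum1 M).
by apply: eq_esum => z _; rewrite probability_setT mule1.
Qed.

Lemma Pr_cat_le U V : Pr M (U ++ V) <= Pr M U.
Proof.
rewrite -lee_fin !PrE; apply: le_esum => z _.
by rewrite lee_wpmul2l ?lee_fin ?prior_ge0// law_begins_with_cat.
Qed.

Lemma prior_le1 z : prior M z <= 1.
Proof.
by rewrite -lee_fin -(prior_sum1 M) esum_ge_term// lee_fin prior_ge0.
Qed.

(** One term of the mixture is kept; this is how the prior enters the final bound. *)
Lemma prior_Pr_given_le z U : prior M z * Pr_given M z U <= Pr M U.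
Proof.
rewrite -lee_fin EFinM Pr_givenE PrE.
exact: (esum_ge_term
  (a := fun z => (prior M z)%:E * law M z (begins_with U))%E).
Qed.

Lemma Pr_next_ge0 U V : 0 <= Pr_next M U V.
Proof. by rewrite divr_ge0// Pr_ge0. Qed.

Lemma Pr_next_le1 U V : Pr_next M U V <= 1.
Proof.
have [U0|U_neq0] := eqVneq (Pr M U) 0; first by rewrite /Pr_next U0 invr0 mulr0.
by rewrite ler_pdivrMr ?mul1r ?Pr_cat_le// lt_neqAle eq_sym U_neq0 Pr_ge0.
Qed.

(** This survives a null [U]: by monotonicity the longer prefix is then null as well. *)
Lemma Pr_cat U V : Pr M (U ++ V) = Pr M U * Pr_next M U V.
Proof.
have [U0|U_neq0] := eqVneq (Pr M U) 0; last by rewrite mulrC divfK.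
by rewrite U0 mul0r; apply/eqP; rewrite eq_le Pr_ge0 andbT -U0 Pr_cat_le.
Qed.

Section inputs.
Context {I : choiceType}.
Variable f : I -> Block.
Hypothesis finj : injective f.

(** The events are told apart by the block right after [U], whatever [V] appends, and all of them
    lie in [begins_with U]. *)
Lemma esum_law_cons_le z U (D : set I) (V : I -> seq Block) :
  (\esum_(a in D) law M z (begins_with (U ++ f a :: V a)) <=
   law M z (begins_with U))%E.
Proof.
apply: esum_le_finite => A _.
apply: (@sum_measure_trivIset_le _ (document Block) _ (law M z) _
  (fun a => begins_with (U ++ f a :: V a))).
- exact: measurable_begins_with.
- by move=> a; exact: measurable_begins_with.
- under [X in trivIset _ X]funext do rewrite -cat_rcons.
  exact: trivIset_begins_with_rcons.
- by move=> a; exact: begins_with_cat.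
Qed.

(** Only a subprobability: the document may end after [U], or go on with a block outside the range
    of [f]. The bound is proved for each latent value and then averaged over the prior. *)
Lemma esum_Pr_next_le1 U :
  (\esum_(a in [set: I]) (Pr_next M U [:: f a])%:E <= 1)%E.
Proof.
apply: esum_le_finite => A _.
rewrite sumEFin lee_fin -mulr_suml.
have [U0|U_neq0] := eqVneq (Pr M U) 0; first by rewrite U0 invr0 mulr0.
rewrite ler_pdivrMr ?mul1r; last by rewrite lt_neqAle eq_sym U_neq0 Pr_ge0.
rewrite -lee_fin -sumEFin; under eq_bigr do rewrite PrE.
rewrite -esum_sum// PrE; apply: le_esum => z _.
rewrite -ge0_sume_distrr//; apply: lee_wpmul2l.
  by rewrite lee_fin prior_ge0.
apply: le_trans (esum_law_cons_le z U [set: I] (fun=> [::])).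
apply: esum_ge; exists [set` A]; first by split.
by rewrite fsbig_finite//= set_fsetK.
Qed.

End inputs.

End prefix_probabilities.

(** * The chain rule along a prompt *)

Section prompt_bound.
Context {R : realType} {Block : countType} {Z : choiceType} {Meaning : Type}.
Context {dX : measure_display} {X : measurableType dX}.
Variable M : latent_model R Block Z Meaning.
Variables (input r : X -> Block) (d : Block).
Implicit Types (U : seq Block).

(* \prod_t Pr(x_t | U, S_{t-1}): verbalizers and delimiters are not paid for. *)
Fixpoint inputs_Pr U (xs : seq X) : R :=
  if xs is a :: xs' then
    Pr_next M U [:: input a] * inputs_Pr (U ++ [:: input a; r a; d]) xs'
  else 1.

Lemma inputs_Pr_ge0 U xs : 0 <= inputs_Pr U xs.
Proof. by elim: xs U => //= a xs IH U; rewrite mulr_ge0// Pr_next_ge0. Qed.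

(** Sum over the first input last: for each [a] the remaining inputs sum to at most 1 after the
    prefix extended by its paragraph, which is why [U] is general. *)
Lemma esum_inputs_Pr_le1 n U : injective input ->
  (\esum_(x in [set: n.-tuple X]) (inputs_Pr U x)%:E <= 1)%E.
Proof.
move=> input_inj; elim: n U => [|n IHn] U.
  have -> : [set: 0.-tuple X] = [set [tuple]].
    by apply/seteqP; split => // x _; exact: tuple0.
  by rewrite esum_set1.
rewrite esum_tupleS; last by move=> x; rewrite lee_fin inputs_Pr_ge0.
apply: le_trans (esum_Pr_next_le1 M input_inj U); apply: le_esum => a _ /=.
under eq_esum do rewrite EFinM.
apply: le_trans (esumZl_le _ _ _) _.
- exact: Pr_next_ge0.
- by move=> x; rewrite lee_fin inputs_Pr_ge0.
- by rewrite -[leRHS]mule1 lee_wpmul2l// lee_fin Pr_next_ge0.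
Qed.

(* The chain rule, dropping the probabilities of the delimiters. *)
Lemma Pr_prompt_le n (x : n.-tuple X) U :
  Pr M (U ++ prompt input r d x) <=
  Pr M U * inputs_Pr U x *
  \prod_(t < n) Pr_next M
    (U ++ rcons (prompt input r d (take t x)) (input (tnth x t)))
    [:: r (tnth x t)].
Proof.
elim: n x U => [x U|n IHn x U].
  by rewrite (tuple0 x) big_ord0 /prompt/= cats0 !mulr1.
case/tupleP: x => a x; rewrite big_ord_recl tnth0.
have -> : U ++ prompt input r d [tuple of a :: x] =
    (U ++ [:: input a; r a; d]) ++ prompt input r d x by rewrite -catA.
apply: le_trans (IHn _ _) _.
under [in leRHS]eq_bigr => t _.
  rewrite tnthS (_ : U ++ _ = (U ++ [:: input a; r a; d]) ++
    rcons (prompt input r d (take t x)) (input (tnth x t))); last first.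
    by rewrite -catA.
  over.
set P := \prod_(t < n) _; set q := inputs_Pr (_ ++ _) _.
have P0 : 0 <= P by apply: prodr_ge0 => t _; exact: Pr_next_ge0.
(* Both sides now share the factors [q] and [P]; what remains is that appending the delimiter cannot
   increase the probability. *)
rewrite [leRHS](_ : _ =
  Pr M ((U ++ [:: input a]) ++ [:: r a]) * q * P); last first.
  rewrite (Pr_cat M (U ++ _)) (Pr_cat M U) [take _ _]/=.
  rewrite -[rcons _ _]/[:: input a] /= -/q; ring.
rewrite ler_wpM2r// ler_wpM2r ?inputs_Pr_ge0//.
rewrite (_ : U ++ _ = ((U ++ [:: input a]) ++ [:: r a]) ++ [:: d]) -?catA//.
by rewrite !catA Pr_cat_le.
Qed.

End prompt_bound.

(** * Gibbs' inequality and the bound on the expected loss *)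

Theorem corollary4p2 (R : realType)
  (* the language model *)
  (Block : countType) (Z : choiceType) (Meaning : Type)
  (M : latent_model R Block Z Meaning) (d : Block)
  (* inputs: a countable set of blocks, with the discrete sigma-algebra *)
  (dX : measure_display) (X : measurableType dX)
  (X_discrete : forall A : set X, measurable A)
  (input : X -> Block) (input_inj : injective input)
  (* the classification task, its class descriptions and its verbalizers *)
  (Y : Type) (label : X -> Y) (v : Y -> Meaning)
  (verbalizer : Y -> Block) (verbalizer_word : forall y, words M (verbalizer y))
  (* the latent value associating each v_y with r_y *)
  (zstar : Z)
  (zstar_meaning : forall y, meaning M zstar (verbalizer y) = v y)
  (zstar_gt0 : 0 < prior M zstar)
  (T : nat) (T_gt0 : (0 < T)%N)
  (DX : probability X R) :
  let r := fun a : X => verbalizer (label a) in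
  let S := prompt input r d in
  (* independence of the paragraphs under z* *)
  (forall x : T.-tuple X,
    Pr_given M zstar (S x) =
    \prod_(t < T) Pr_given M zstar [:: input (tnth x t); r (tnth x t); d]) ->
  (* consistency, where the conditioning event is possible *)
  (forall (x : T.-tuple X) (t : 'I_T),
    0 < Pr_given M zstar (rcons (S (take t x)) (input (tnth x t))) ->
    Pr_next_given M zstar (rcons (S (take t x)) (input (tnth x t)))
      [:: r (tnth x t); d] = 1) ->
  (* D_X is the input marginal of the paragraph distribution under z* *)
  (forall a : X,
    DX [set a] =
    (\esum_(g in words M) (Pr_given M zstar [:: input a; g; d])%:E)%E) ->
  (((T%:R^-1 * ln (prior M zstar))%:E <=
    \int[iid DX T]_x
      ((T%:R^-1)%:E *
       \sum_(t < T)
         lne (Pr_next M (rcons (S (take t x)) (input (tnth x t)))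
                [:: r (tnth x t)])%:E))%E).
Proof.
move=> r S indep consistent DXE.
have cX : countable [set: X].
  apply/countable_injP; exists (choice.pickle \o input) => a b _ _.
  by move=> /(pcan_inj choice.pickleK)/input_inj.
have mX (a : X) : measurable [set a] by exact: X_discrete.
(* In the sum over verbalizers only the correct one counts: the paragraphs are disjoint events
   inside [begins_with [:: input a]], and by consistency the correct one already has the full
   probability of that event. *)
have DX1 a : DX [set a] = (Pr_given M zstar [:: input a; r a; d])%:E.
  rewrite DXE; apply/eqP; rewrite eq_le; apply/andP; split; last first.
    apply: (esum_ge_term
      (a := fun g => (Pr_given M zstar [:: input a; g; d])%:E)).
      exact: verbalizer_word.
    by rewrite lee_fin Pr_given_ge0.
  under eq_esum do rewrite Pr_givenE.
  apply: le_trans (_ : law M zstar (begins_with [:: input a]) <= _)%E.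
    exact: (@esum_law_cons_le _ _ _ _ M Block id (@inj_id _) _ [:: input a]
      (words M) (fun=> [:: d])).
  rewrite -Pr_givenE lee_fin.
  have [->|ia_gt0] := eqVneq (Pr_given M zstar [:: input a]) 0.
    exact: Pr_given_ge0.
  have {}ia_gt0 : 0 < Pr_given M zstar [:: input a].
    by rewrite lt_neqAle eq_sym ia_gt0 Pr_given_ge0.
  (* Any tuple starting with [a] would do; at position 0 the preceding prompt is empty. *)
  have := consistent [tuple a | _ < T] (Ordinal T_gt0).
  rewrite take0 tnth_mktuple => /(_ ia_gt0)/divr1_eq ira.
  by rewrite (_ : Pr_given M zstar [:: input a; r a; d] =
                  Pr_given M zstar [:: input a]).
have iidE x : iid DX T [set x] = (Pr_given M zstar (S x))%:E.
  by rewrite iid_set1// indep -prodEFin; apply: eq_bigr => t _; exact: DX1.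
pose next (x : T.-tuple X) (t : 'I_T) : R :=
  Pr_next M (rcons (S (take t x)) (input (tnth x t))) [:: r (tnth x t)].
pose q (x : seq X) : R := inputs_Pr M input r d [::] x.
pose loss (x : T.-tuple X) : \bar R :=
  ((T%:R^-1)%:E * - \sum_(t < T) lne (next x t)%:E)%E.
have T0 : (0 : R) < T%:R^-1 by rewrite invr_gt0 ltr0n.
have loss_ge0 x : (0 <= loss x)%E.
  apply: mule_ge0; first by rewrite lee_fin ltW.
  rewrite oppe_ge0 sume_le0// => t _.
  by rewrite lne_le0 lee_fin Pr_next_le1.
have L0 : 0 <= - ln (prior M zstar).
  by rewrite oppr_ge0 ln_le0// prior_le1.
(* log (Q / q) >= 1 - q / Q, where Q is the law of the inputs under z*. *)
have loss_le x : ((loss x + (T%:R^-1)%:E) * iid DX T [set x] <=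
    (T%:R^-1 * - ln (prior M zstar))%:E * iid DX T [set x] +
    (T%:R^-1)%:E * (q x)%:E)%E.
  rewrite iidE; set Q := Pr_given _ _ _.
  have q0 : 0 <= q x by exact: inputs_Pr_ge0.
  (* Where [Q] vanishes the loss may be [+oo], but its product with 0 is 0. *)
  have [->|Q_neq0] := eqVneq Q 0.
    by rewrite !mule0 add0e mule_ge0 ?lee_fin// ltW.
  have Q_gt0 : 0 < Q by rewrite lt_neqAle eq_sym Q_neq0 Pr_given_ge0.
  (* Since [prior M zstar * Q] is positive and at most [q x] times the product of the [next x t],
     all these factors are positive and every logarithm below is finite. *)
  have := le_trans (prior_Pr_given_le M zstar _)
    (Pr_prompt_le M input r d x [::]).
  rewrite -/S -/Q -/(q x) Pr_nil mul1r => pQ_le.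
  have next0 t : 0 <= next x t by exact: Pr_next_ge0.
  have P0 : 0 <= \prod_(t < T) next x t by exact: prodr_ge0.
  have qP_gt0 : 0 < q x * \prod_(t < T) next x t.
    by apply: lt_le_trans pQ_le; rewrite mulr_gt0.
  have q_gt0 : 0 < q x.
    rewrite lt_neqAle eq_sym q0 andbT.
    by apply: contraTneq qP_gt0 => ->; rewrite mul0r ltxx.
  have P_gt0 : 0 < \prod_(t < T) next x t by rewrite -(pmulr_rgt0 _ q_gt0).
  have next_gt0 t : 0 < next x t.
    rewrite lt_neqAle eq_sym next0 andbT.
    by have /gt_eqF/negbT/prodf_neq0 := P_gt0; exact.
  have [_ sum_lne] : 0 < \prod_(t < T) next x t /\
      (\sum_(t < T) lne (next x t)%:E = (ln (\prod_(t < T) next x t))%:E)%E.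
    apply: (big_ind2 (fun (p : R) (l : \bar R) => 0 < p /\ l = (ln p)%:E)).
    - by rewrite ln1.
    - move=> p1 l1 p2 l2 [p1_gt0 ->] [p2_gt0 ->].
      by rewrite mulr_gt0// lnM// EFinD.
    - by move=> t _; rewrite lne_EFin.
  rewrite /loss sum_lne -EFinN -!EFinM -!EFinD lee_fin.
  set P := \prod_(t < T) _ in P_gt0 pQ_le qP_gt0 *.
  have ln_pQ : ln (prior M zstar) + ln Q <= ln (q x) + ln P.
    by rewrite -!lnM ?posrE// ler_ln ?posrE// mulr_gt0.
  (* The inequality [ln u <= u - 1] at [u = q x / Q], multiplied by [Q]. *)
  have qQ : Q * (ln (q x) - ln Q) <= q x - Q.
    have : ln (1 + (q x / Q - 1)) <= q x / Q - 1.
      by rewrite le_ln1Dx// ltrBrDr addNr divr_gt0.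
    rewrite subrKC ln_div// -(ler_pM2l Q_gt0) => /le_trans; apply.
    by rewrite mulrBr mulr1 mulrC divfK.
  rewrite -subr_ge0.
  rewrite (_ : _ - _ = T%:R^-1 * (Q * (ln P - ln (prior M zstar)) + (q x - Q))).
    by apply: mulr_ge0; [exact: ltW|nra].
  by ring.
under eq_integral => x _ do
  rewrite -[X in (_ * X)%E]oppeK muleN -/(loss x).
rewrite integral_ge0N// leeNr -EFinN -mulrN.
(* Adding the constant to both sides, rather than subtracting it under the integral, keeps every
   integrand nonnegative. *)
rewrite -(@leeD2rE _ (T%:R^-1)%:E)//.
have cstE c : (\int[iid DX T]_x c%:E = c%:E)%E.
  by rewrite integral_cst// [X in (_ * X)%E]probability_setT mule1.
have cXT := countable_tuple cX T; have mXT := measurable_tuple1 mX (n := T).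
rewrite -[in leLHS](cstE T%:R^-1) -ge0_integralD//; last first.
  exact: countable_measurable_fun.
rewrite ge0_integral_countable//; last first.
  by move=> x; rewrite adde_ge0// lee_fin ltW.
apply: le_trans (le_esum (fun x _ => loss_le x)) _.
rewrite esumD; last 2 first.
- by move=> x _; rewrite mule_ge0// lee_fin mulr_ge0// ltW.
- by move=> x _; rewrite mule_ge0// lee_fin ?inputs_Pr_ge0// ltW.
(* The first sum is the integral of a constant against a probability; the second is at most the
   added constant because [q] has total mass at most 1. *)
apply: leeD.
  rewrite -(ge0_integral_countable cXT mXT (iid DX T)
    (f := cst (T%:R^-1 * - ln (prior M zstar))%:E)) ?cstE// => x.
  by rewrite lee_fin mulr_ge0// ltW.
apply: le_trans (esumZl_le _ _ _) _.
- exact: ltW.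
- by move=> x; rewrite lee_fin inputs_Pr_ge0.
rewrite -[leRHS]mule1; apply: lee_wpmul2l; first by rewrite lee_fin ltW.
exact: esum_inputs_Pr_le1.
Qed.
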